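(* Let $\mu$ be an infinite ergodic $\mathcal{R}$-invariant measure on a stationary Bratteli diagram $B$ with incidence matrix $F$, defined by a non-distinguished eigenvalue $\lambda$ of the matrix $A=F^T$. Denote by $x=(x_1,\ldots,x_n)^T$ the corresponding reduced vector. Let the vertices $m+1,\ldots,n$ be those belonging to the class $\alpha$ corresponding to $\mu$. Then $\mu$ is good if and only if there exists $R\in\mathbb{N}$ such that $\lambda^Rx_1,\ldots,\lambda^Rx_m$ belong to the additive group generated by $\{x_j\}_{j=m+1}^n$. If $S(\mu)$ consists of rational numbers and $\left(\frac{p_1}{q},\ldots,\frac{p_n}{q}\right)^T$ (with $p_1,\ldots,p_n,q$ positive integers) is the corresponding reduced vector, then $\mu$ is good if and only if $\gcd(p_{m+1},\ldots,p_n)\mid\lambda^R$ for some $R\in\mathbb{N}$.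
   Context: Stationary Bratteli diagrams. Let $F=(f_{ij})$ be a $K\times K$ matrix of non-negative integers without zero rows or columns. The stationary Bratteli diagram $B$ with incidence matrix $F$ has levels $V_0=\{v_0\}$ and, for $k\ge1$, $V_k$ a copy of $\{1,\dots,K\}$; there is one edge from $v_0$ to each vertex of $V_1$ and, for $k\ge1$, $f_{ij}$ edges from vertex $j$ of $V_k$ to vertex $i$ of $V_{k+1}$. $X_B$ is the space of infinite paths starting at $v_0$, with topology generated by the (clopen) cylinder sets of paths with a prescribed initial segment; a cylinder set given by a path of length $N$ from $v_0$ to $i\in V_N$ is said to end in the vertex $i$ on level $N$. The tail (cofinal) equivalence relation $\mathcal{R}$ on $X_B$ relates two paths if they coincide from some level on; it is assumed aperiodic (all classes infinite). A measure is $\mathcal{R}$-invariant if for any two finite paths $e,e'$ from $v_0$ to the same vertex, replacing the initial segment $e$ by $e'$ preserves the measure (so cylinders ending in the same vertex of the same level have equal measure); it is ergodic if every $\mathcal{R}$-invariant Borel set is null or has null complement. Vertex classes are the strongly connected components of the directed graph on $\{1,\dots,K\}$ with $j\to i$ iff $f_{ij}>0$; $\beta\prec\alpha$ means $\beta\ne\alpha$ and there is a directed path from $\beta$ to $\alpha$. Put $A=F^T$, and let $A_\alpha$ be its restriction to $\alpha$; non-zero $A_\alpha$ are primitive (achieved by telescoping). $X_\alpha$ is the set of paths that eventually pass only through vertices of $\alpha$. The ergodic $\mathcal{R}$-invariant measures considered are the following: to a class $\alpha$ whose block has Perron–Frobenius eigenvalue $\lambda>1$ corresponds the $\mathcal{R}$-invariant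 measure $\mu$ (unique up to scaling) with $\mu(X_B\setminus X_\alpha)=0$ and measure $\xi_i/\lambda^{N-1}$ for the part in which the path stays in $\alpha$ of each cylinder ending in $i\in\alpha$ on level $N$, where $A_\alpha\xi=\lambda\xi$, $\xi>0$. It is finite iff $\lambda$ exceeds the spectral radius of $A_\beta$ for all $\beta\prec\alpha$ ($\lambda$ distinguished), and infinite otherwise ($\lambda$ non-distinguished). Measures are considered only on their supports, so all vertices belong to $\alpha$ or to classes $\beta\prec\alpha$ and $\mu$ is full (every non-empty open set has positive measure). For infinite $\mu$, let $B_f$ be the subdiagram whose vertices are those of $\alpha$ and of all $\beta\prec\alpha$ for which cylinders ending in $\beta$ have finite $\mu$-measure, with all edges of $B$ between them; number its vertices $1,\dots,n$. The reduced vector $x=(x_1,\dots,x_n)^T$ is the positive vector with $A_fx=\lambda x$ ($A_f$ the transpose of the incidence matrix of $B_f$), $\sum x_i=1$; $\mu$ is normalized so that each cylinder ending in vertex $i$ of $B_f$ on level $N$ has measure $x_i/\lambda^{N-1}$. $S(\mu)=\{\mu(U):U\text{ clopen in }X_B,\ \mu(U)<\infty\}$. $\mu$ is good if for all clopen $U,V\subset X_B$ with $\mu(U)<\mu(V)$ there is a clopen $W\subset V$ with $\mu(W)=\mu(U)$.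
   Formalization: In the second part the representation (p_1/q,…,p_n/q) of the reduced vector is required to be in lowest terms, gcd(q,p_1,…,p_n)=1; without this the stated divisibility criterion fails (e.g. n=1, m=0, λ=2, x=(3/3)). *)

(* Defs.v *)
From HB Require Import structures.
From mathcomp Require Import all_boot all_order all_algebra.
From mathcomp Require Import complex.
From mathcomp Require Import all_classical all_reals all_analysis.

Set Implicit Arguments.
Unset Strict Implicit.
Unset Printing Implicit Defensive.

Import Order.TTheory GRing.Theory Num.Theory.
Import numFieldNormedType.Exports.

Local Open Scope classical_set_scope.
Local Open Scope ring_scope.

(* [incidence i j] is the number of edges from vertex [j] of a level [k >= 1]
   to vertex [i] of level [k + 1]; there is one edge from the root to each
   vertex of level 1. *)
Record stationary_diagram := StationaryDiagram {
  nverts : nat;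
  incidence : 'M[nat]_nverts;
  nverts_gt0 : (0 < nverts)%N;
  incidence_row : forall i, [exists j, (0 < incidence i j)%N];
  incidence_col : forall j, [exists i, (0 < incidence i j)%N]
}.

Notation vertex B := 'I_(nverts B).

(* The [k]-th term of a path is its vertex on level [k + 1] together with the
   label of the edge it takes from there to level [k + 2]. The first edge is
   determined by the vertex on level 1. *)
Definition is_path (B : stationary_diagram) (s : nat -> vertex B * nat) :=
  forall k, ((s k).2 < incidence B (s k.+1).1 (s k).1)%N.

Definition bpath (B : stationary_diagram) : Type :=
  {s : nat -> vertex B * nat | `[< is_path s >]}.

Section PathSpace.
Variable B : stationary_diagram.

HB.instance Definition _ := gen_eqMixin (bpath B).
HB.instance Definition _ := gen_choiceMixin (bpath B).

Definition next_vertex (j : vertex B) : vertex B :=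
  xchoose (existsP (incidence_col j)).

Definition base_seq (k : nat) : vertex B * nat :=
  (iter k next_vertex (Ordinal (nverts_gt0 B)), 0%N).

Lemma base_seqP : `[< is_path base_seq >].
Proof. by apply/asboolP => k /=; exact: (xchooseP (existsP (incidence_col _))). Qed.

(* The library's measurable spaces must be inhabited. *)
HB.instance Definition _ := isPointed.Build (bpath B) (exist _ base_seq base_seqP).

Implicit Types (x y : bpath B) (k : nat) (A : set (bpath B)).

(* The vertex of [x] on level [k + 1]. *)
Definition vert x k : vertex B := (sval x k).1.

(* The cylinder set of the initial segment of [x] from the root to level
   [k + 1]. As every vertex has an outgoing edge, every finite path of positive
   length is such a segment, so these are all the cylinder sets. *)
Definition cylinder x k : set (bpath B) :=
  [set y | vert y k = vert x k /\
           forall j, (j < k)%N -> sval y j = sval x j].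

HB.instance Definition _ := isSubBaseTopological.Build (bpath B)
  (range (fun xk : bpath B * nat => cylinder xk.1 xk.2)) id.

Definition tail_equiv x y :=
  exists N, forall k, (N <= k)%N -> sval x k = sval y k.

(* The paths obtained from those in [A] by replacing the segment from the root
   to level [k + 1] by that of [x]. *)
Definition replace_initial x k A : set (bpath B) :=
  [set z | cylinder x k z /\
           exists2 y, A y & forall j, (k <= j)%N -> sval z j = sval y j].

Definition eventually_in (alpha : {set vertex B}) : set (bpath B) :=
  [set x | exists N, forall k, (N <= k)%N -> vert x k \in alpha].

Definition edge_rel : rel (vertex B) := fun j i => (0 < incidence B i j)%N.

Definition vertex_class (alpha : {set vertex B}) :=
  exists v, alpha = [set w | connect edge_rel v w && connect edge_rel w v]%SET.

Definition precedes (beta alpha : {set vertex B}) :=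
  beta <> alpha /\
  exists v w, [/\ v \in beta, w \in alpha & connect edge_rel v w].

End PathSpace.

Definition aperiodic (B : stationary_diagram) :=
  forall x : bpath B, infinite_set [set y | tail_equiv x y].

Notation borel_paths B := (g_sigma_algebraType (@open (bpath B))).

Section Matrices.
Variable R : realType.

Definition primitive n (M : 'M[R]_n) :=
  exists2 k, (0 < k)%N & forall i j, 0 < (M ^+ k) i j.

Definition spectral_radius n (M : 'M[R]_n) : R :=
  sup [set Normc.normc z |
       z in [set z : R[i] | eigenvalue (map_mx (real_complex R) M) z]].

Definition adj (B : stationary_diagram) : 'M[R]_(nverts B) :=
  map_mx (fun k : nat => k%:R) (incidence B)^T.

Definition block (B : stationary_diagram) (beta : {set vertex B}) :
    'M[R]_#|beta| :=
  mxsub (fun i : 'I_#|beta| => enum_val i) (fun i : 'I_#|beta| => enum_val i)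
    (adj B).

(* Restriction of the matrix to the vertices enumerated by [v]. *)
Definition subdiagram_mx (B : stationary_diagram) n (v : 'I_n -> vertex B) :
    'M[R]_n := mxsub v v (adj B).

Definition distinguished (B : stationary_diagram) (alpha : {set vertex B})
    (lambda : R) :=
  forall beta : {set vertex B}, vertex_class beta -> precedes beta alpha ->
    spectral_radius (block beta) < lambda.

(* The additive subgroup generated by [S]. *)
Definition addgroup_gen (V : zmodType) (S : set V) : set V :=
  smallest [set H : set V | zmod_closed [pred u | u \in H]] S.

End Matrices.

Section Measures.
Variables (R : realType) (B : stationary_diagram).
Variable mu : {measure set (borel_paths B) -> \bar R}.

Definition tail_invariant_measure :=
  forall (x x' : bpath B) (k : nat) (A : set (borel_paths B)),
    vert x k = vert x' k -> measurable A -> A `<=` cylinder x k ->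
    mu (replace_initial x' k A) = mu A.

Definition tail_ergodic :=
  forall A : set (borel_paths B), measurable A ->
    (forall x y : bpath B, tail_equiv x y -> A x -> A y) ->
    mu A = 0%E \/ mu (~` A) = 0%E.

Definition full_measure :=
  forall U : set (bpath B), open U -> U !=set0 -> (0 < mu U)%E.

(* [mu] is the measure that the class [alpha] and the Perron-Frobenius
   eigenvalue [lambda] of its block define; [xi] is determined up to a positive
   factor, as [mu] is. Level [N] is [k + 1]. *)
Definition defined_by (alpha : {set vertex B}) (lambda : R) :=
  mu (~` eventually_in alpha) = 0%E /\
  exists xi : 'cV[R]_#|alpha|,
    [/\ forall i, 0 < xi i 0,
        block R alpha *m xi = lambda *: xi &
        forall (x : bpath B) (k : nat) (i : 'I_#|alpha|),
          vert x k = enum_val i ->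
          mu (cylinder x k `&`
              [set y | forall j, (k <= j)%N -> vert y j \in alpha])
            = (xi i 0 / lambda ^+ k)%:E].

Definition finite_class (beta : {set vertex B}) :=
  forall (x : bpath B) (k : nat), vert x k \in beta ->
    (mu (cylinder x k) < +oo)%E.

Definition finite_part (alpha : {set vertex B}) : set (vertex B) :=
  [set i | i \in alpha \/
     exists beta : {set vertex B},
       [/\ vertex_class beta, precedes beta alpha, finite_class beta &
           i \in beta]].

(* [v] numbers the vertices of the subdiagram of [mu], and [mu] is normalized
   accordingly. *)
Definition reduced_vector (lambda : R) n (v : 'I_n -> vertex B)
    (x : 'cV[R]_n) :=
  [/\ forall i, 0 < x i 0,
      subdiagram_mx R v *m x = lambda *: x,
      \sum_i x i 0 = 1 &
      forall (y : bpath B) (k : nat) (i : 'I_n), vert y k = v i ->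
        mu (cylinder y k) = (x i 0 / lambda ^+ k)%:E].

Definition clopen_values : set R :=
  [set fine (mu U) |
   U in [set U : set (bpath B) | clopen U /\ (mu U < +oo)%E]].

Definition good :=
  forall U V : set (bpath B), clopen U -> clopen V -> (mu U < mu V)%E ->
    exists W : set (bpath B), [/\ clopen W, W `<=` V & mu W = mu U].

End Measures.

(* Main.v *)
Require Import Defs.
From HB Require Import structures.
From mathcomp Require Import all_boot all_order all_algebra.
From mathcomp Require Import complex finmap.
From mathcomp Require Import all_classical all_reals all_analysis.
Set Implicit Arguments.
Unset Strict Implicit.
Unset Printing Implicit Defensive.
Import Order.TTheory GRing.Theory Num.Theory.
Import numFieldNormedType.Exports.
Local Open Scope classical_set_scope.
Local Open Scope ring_scope.

(* A clopen set of finite measure is a finite union of cylinders of one large level N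
   that end in vertices of the subdiagram, so its measure is lambda^{-N} times a
   natural combination of the x_i; if the set lies in the cylinders ending in alpha,
   only the x_j with j > m occur. Let H be the group that these x_j generate;
   lambda H is contained in H. If mu is good, a cylinder ending in i <= m on a high
   level has the measure of a clopen subset of a fixed cylinder ending in alpha, which
   puts lambda^R x_i in H. Conversely, let U and V be clopen with mu(U) < mu(V). As mu
   is carried by the paths that are eventually in alpha, one may shrink V to a clopen
   set inside cylinders ending in alpha. On a level K, lambda^{K-1} mu(U) is in H,
   i.e. it is <u, x> for an integer vector u, and that of V is <c, x> with c counting
   cylinders. By Perron-Frobenius, u A^d and (c - u) A^d are positive for large d, so
   d levels further V contains as many cylinders of each type as u A^d asks for.
   The rational case follows since H = (gcd(p_j : j > m) / q) Z and the gcd of all the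
   p_i is 1. *)

(** * Cylinders, clopen sets and the counting of finite paths *)

Section Paths.
Variable B : stationary_diagram.
Implicit Types (x y z : bpath B) (U V : set (bpath B)) (k M N : nat).

Lemma path_edge x k : ((sval x k).2 < incidence B (vert x k.+1) (vert x k))%N.
Proof. by case: x => s /= /[dup] + hs; move=> /asboolP; apply. Qed.

Lemma cylinder_id x k : cylinder x k x. Proof. by []. Qed.

Lemma cylinder_sym x y k : cylinder x k y -> cylinder y k x.
Proof. by case=> h1 h2; split=> [|j jk]; rewrite ?h1 ?h2. Qed.

Lemma cylinder_trans x y z k : cylinder x k y -> cylinder y k z -> cylinder x k z.
Proof.
by case=> h1 h2 [h3 h4]; split=> [|j jk]; [rewrite h3|rewrite h4// h2].
Qed.

Lemma cylinder_vert x y k j : (j <= k)%N -> cylinder x k y -> vert y j = vert x j.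
Proof.
by rewrite leq_eqVlt => /predU1P[-> []//|jk [_ h]]; rewrite /vert h.
Qed.

Lemma cylinder_le x k N : (k <= N)%N -> cylinder x N `<=` cylinder x k.
Proof.
move=> kN y hy; split; first exact: cylinder_vert hy.
by move=> j jk; case: hy => _; apply; apply: leq_trans kN.
Qed.

Lemma open_cylinder x k : open (cylinder x k).
Proof.
exists [set cylinder x k]; last by rewrite bigcup_set1.
move=> _ ->; exists (fset1 (cylinder x k)).
  by move=> i /fset1P ->; apply: mem_set; exists (x, k).
rewrite predeqE => z; split=> [h|h i /=]; last by move=> /fset1P ->.
by apply: (h (cylinder x k)); exact/fset1P.
Qed.

(** Cylinders through a point are nested, so a finite intersection of them around [x] contains the
    cylinder of [x] at the largest index involved. *)
Lemma open_pathsP U : open U <-> forall x, U x -> exists k, cylinder x k `<=` U.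
Proof.
split=> [[D' DD' <-] x [i D'i ix]|h].
  have [F FD iE] := DD' _ D'i.
  suff [k kF] : exists k, forall c, c \in F -> cylinder x k `<=` c.
    have ki : cylinder x k `<=` i by move=> y xy; rewrite -iE => c cF; exact: kF xy.
    by exists k => y /ki iy; exists i.
  have hc (c : set (bpath B)) : exists k, c \in F -> cylinder x k `<=` c.
    case: (boolP (c \in F)) => cF; last by exists 0%N.
    have /set_mem[[z k] _ /= ci] := FD _ cF.
    have xc : c x by move: (ix : i x); rewrite -iE; apply.
    exists k => _ y xy; rewrite -ci; apply: (cylinder_trans _ xy).
    by rewrite ci.
  have [f fP] := choice hc.
  exists (\max_(c <- F) f c)%N => c cF; apply: subset_trans (fP c cF).
  exact/cylinder_le/leq_bigmax_seq.
have -> : U = \bigcup_(c in [set c | exists xk, c = cylinder xk.1 xk.2 /\ c `<=` U]) c.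
  rewrite eqEsubset; split=> [x /h[k kU]|x [c [xk [_ cU]] /cU//]].
  by exists (cylinder x k) => //; exists (x, k).
by apply: bigcup_open => c [xk [-> _]]; exact: open_cylinder.
Qed.

(** These are the unions of cylinders ending on level N + 1. Indices are levels minus one, so
    [lambda ^+ N] is the normalizing power for that level. *)
Definition determined U N := forall y, U y -> cylinder y N `<=` U.

Lemma determined_le U N M : (N <= M)%N -> determined U N -> determined U M.
Proof. by move=> NM h y /h; apply: subset_trans; exact: cylinder_le. Qed.

Lemma determined_clopen U N : determined U N -> clopen U.
Proof.
move=> h; split; first by apply/open_pathsP => x /h; exists N.
rewrite -openC; apply/open_pathsP => x nUx; exists N => y xy Uy.
by apply: nUx; apply: (h _ Uy); exact: cylinder_sym.
Qed.

(** A common bound on the edge labels puts all finite paths of one length into a single finite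
    type. *)
Definition label_bound : nat := \max_(j : vertex B) \max_(i : vertex B) incidence B i j.

Lemma label_lt x k : ((sval x k).2 < label_bound.+1)%N.
Proof.
rewrite ltnS; apply: leq_trans (ltnW (path_edge x k)) _.
apply: leq_trans (leq_bigmax _) (leq_bigmax (vert x k)); exact.
Qed.

Section Glue.
Variables (x : nat -> bpath B).
Hypothesis hx : forall k, cylinder (x k) k (x k.+1).

Lemma nested_cylinder k d : cylinder (x k) k (x (k + d)%N).
Proof.
elim: d => [|d IH]; first by rewrite addn0.
rewrite addnS; apply: cylinder_trans IH _.
by apply: cylinder_le (hx _); exact: leq_addr.
Qed.

Lemma nested_cylinders_meet : exists z, forall k, cylinder (x k) k z.
Proof.
(* [cylinder (x k) k] fixes only the vertex of entry [k], not its edge label; the whole entry is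
   settled from [x k.+1] on. *)
pose s k := sval (x k.+1) k.
have sE k N : (k < N)%N -> sval (x N) k = s k.
  move=> kN; have := nested_cylinder k.+1 (N - k.+1).
  by rewrite subnKC// => -[_ ->].
have sP : `[< is_path s >].
  apply/asboolP => k; rewrite -(@sE k k.+2)//; exact: (path_edge (x k.+2) k).
exists (exist _ s sP) => k; split; last by move=> j jk /=; rewrite sE.
by rewrite /vert /= /s; have [] := hx k.
Qed.

End Glue.

(** König's lemma. If no level decides membership in [U], some first-level cylinder is undecided;
    having finitely many one-edge extensions, an undecided cylinder contains an undecided one a
    level further. The limit path lies in [U] or in its complement, and as both are open, some
    cylinder around it is decided. *)
Lemma clopen_determined U : clopen U -> exists N, determined U N.
Proof.
move=> [oU cU].
pose dec x k N := forall y, cylinder x k y -> cylinder y N `<=` U \/ cylinder y N `<=` ~` U.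
have decW x k N M : (N <= M)%N -> dec x k N -> dec x k M.
  by move=> NM h y /h [] h'; [left|right]; apply: subset_trans h'; exact: cylinder_le.
pose bad x k := forall N, ~ dec x k N.
have step x k : bad x k -> exists y, cylinder x k y /\ bad y k.+1.
  move=> b; apply: contrapT => nex.
  have hc (e : 'I_label_bound.+1 * vertex B) : exists N, forall y, cylinder x k y ->
      (sval y k).2 = e.1 -> vert y k.+1 = e.2 -> dec y k.+1 N.
    case: (pselect (exists y, [/\ cylinder x k y, (sval y k).2 = e.1 & vert y k.+1 = e.2])).
      move=> [y [xy y1 y2]]; have /existsNP[N /contrapT hN] : ~ bad y k.+1.
        by move=> by_; apply: nex; exists y.
      exists N => z xz z1 z2 t zt; apply: hN; apply: cylinder_trans zt.
      split; first by rewrite z2.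
      move=> j; rewrite ltnS leq_eqVlt => /predU1P[->|jk]; last by rewrite xz.2// xy.2.
      case: xz => xz _; case: xy => xy _; move: xz xy z1 y1; rewrite /vert.
      by case: (sval z k) => a b1; case: (sval y k) => c d /= -> -> -> ->.
    by move=> h; exists 0%N => y xy y1 y2; exfalso; apply: h; exists y.
  have [f fP] := choice hc.
  apply: (b (\max_e f e)%N) => y xy.
  pose e := (Ordinal (label_lt y k), vert y k.+1).
  apply: (decW _ _ _ _ (leq_bigmax e) (fP e y xy erefl erefl)); exact: cylinder_id.
have start : (forall x, ~ bad x 0%N) -> exists N, determined U N.
  move=> nb; have hc (i : vertex B) : exists N, forall x, vert x 0 = i -> dec x 0%N N.
    case: (pselect (exists x, vert x 0 = i)) => [[x xi]|h].
      have /existsNP[N /contrapT hN] := nb x.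
      by exists N => z zi t zt; apply: hN; apply: cylinder_trans zt; split; rewrite // zi.
    by exists 0%N => x xi; exfalso; apply: h; exists x.
  have [f fP] := choice hc.
  exists (\max_i f i)%N => y Uy.
  have [//|h] := decW _ _ _ _ (leq_bigmax (vert y 0)) (fP _ y erefl) y (cylinder_id y 0).
  by case: (h y (cylinder_id y _)).
apply: contrapT => nN; apply: nN; apply: start => x0 b0.
have hc (xk : bpath B * nat) : exists y, bad xk.1 xk.2 -> cylinder xk.1 xk.2 y /\ bad y xk.2.+1.
  case: (pselect (bad xk.1 xk.2)) => [/step[y yP]|nb]; first by exists y.
  by exists x0 => /nb.
have [f fP] := choice hc.
pose x := fix x k := if k is k'.+1 then f (x k', k') else x0.
have bx k : bad (x k) k.
  by elim: k => [|k IH]; [exact: b0 | have [] := fP (x k, k) IH].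
have [|z zP] := @nested_cylinders_meet x.
  by move=> k; have [] := fP (x k, k) (bx k).
have bz k N : ~ dec z k N.
  by move=> h; apply: (bx k N) => y xy; apply: h; apply: cylinder_trans xy; exact/cylinder_sym.
case: (pselect (U z)) => [Uz|nUz].
  have /open_pathsP/(_ z Uz)[k kU] := oU.
  apply: (bz k k) => y zy; left; apply: subset_trans kU => t; exact: cylinder_trans.
have : open (~` U) by rewrite openC.
move=> /open_pathsP/(_ z nUz)[k kU].
by apply: (bz k k) => y zy; right; apply: subset_trans kU => t; exact: cylinder_trans.
Qed.

(** The type also contains tuples that are not paths; [prefixes] keeps only those that a path
    realizes. *)
Fixpoint prefix k : finType :=
  if k is k'.+1 then (prefix k' * 'I_label_bound.+1 * vertex B)%type : finType
  else vertex B : finType.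

Fixpoint prefix_of x k : prefix k :=
  if k is k'.+1 then (prefix_of x k', inord (sval x k').2, vert x k) : prefix k'.+1
  else vert x 0.

Definition prefix_end k : prefix k -> vertex B :=
  if k is k'.+1 then fun p : prefix k'.+1 => p.2 else id.

Lemma prefix_end_of x k : prefix_end (prefix_of x k) = vert x k.
Proof. by case: k. Qed.

Lemma prefix_ofP x y k : prefix_of y k = prefix_of x k <-> cylinder x k y.
Proof.
elim: k => [|k IH] /=; first by split=> [h|[]//]; split.
split=> [[/IH[h1 h2] hl hv]|[hv hs]].
  split=> // j; rewrite ltnS leq_eqVlt => /predU1P[->|/h2//].
  move/(congr1 val): hl h1; rewrite /= !inordK ?label_lt// /vert.
  by case: (sval y k) => a b; case: (sval x k) => c d /= -> ->.
congr (_, _, _) => //; last by rewrite hs.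
by apply/IH; split=> [|j jk]; [rewrite /vert hs | rewrite hs// ltnW].
Qed.

Lemma path_extension x k (l : nat) (j : vertex B) : (l < incidence B j (vert x k))%N ->
  exists y, [/\ cylinder x k y, (sval y k).2 = l & vert y k.+1 = j].
Proof.
move=> lj.
(* After the prescribed edge the path follows [next_vertex] with label 0, an edge that exists
   because no column is zero. *)
pose s i := if (i < k)%N then sval x i else if i == k then (vert x k, l)
            else (iter (i - k.+1) (@next_vertex B) j, 0%N).
have sP : `[< is_path s >].
  apply/asboolP => i; rewrite /s.
  case: (ltngtP i.+1 k) => [ik|ik|<-].
  - exact: path_edge.
  - rewrite ltnS in ik.
    case: eqP => [-> /=|ne]; first by rewrite subnn.
    have {ne}ik : (k < i)%N by rewrite ltn_neqAle ik andbT; apply/eqP/nesym.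
    by rewrite subSn//=; exact: (xchooseP (existsP (incidence_col _))).
  - exact: path_edge.
exists (exist _ s sP); split; first split.
- by rewrite /vert /= /s ltnn eqxx.
- by move=> i ik /=; rewrite /s ik.
- by rewrite /= /s ltnn eqxx.
- by rewrite /vert /= /s ltnNge leqnSn /= gtn_eqF// subnn.
Qed.

Lemma path_through (i : vertex B) k : exists x, vert x k = i.
Proof.
elim: k i => [|k IH] i.
  pose s n := (iter n (@next_vertex B) i, 0%N).
  have sP : `[< is_path s >].
    by apply/asboolP => n /=; exact: (xchooseP (existsP (incidence_col _))).
  by exists (exist _ s sP).
have /existsP[j ji] := incidence_row i.
have [x xj] := IH j; rewrite -xj in ji.
by have [y [_ _ yi]] := path_extension ji; exists y.
Qed.

Definition prefixes U k : {set prefix k} :=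
  [set p | `[< exists2 y, U y & prefix_of y k = p >]]%SET.

Lemma prefixesP U k (p : prefix k) :
  reflect (exists2 y, U y & prefix_of y k = p) (p \in prefixes U k).
Proof. by rewrite inE; exact: asboolP. Qed.

Lemma mem_prefixes U k y : U y -> prefix_of y k \in prefixes U k.
Proof. by move=> Uy; apply/prefixesP; exists y. Qed.

Definition cell k (p : prefix k) : set (bpath B) := [set y | prefix_of y k = p].

Lemma cell_prefix_of x k : cell (prefix_of x k) = cylinder x k.
Proof. by rewrite predeqE => y; exact: prefix_ofP. Qed.

Lemma determined_cells U N : determined U N ->
  U = \bigcup_(p in [set` prefixes U N]) cell p.
Proof.
move=> dU; rewrite predeqE => y; split=> [Uy|[p /prefixesP[z Uz zp] yp]].
  by exists (prefix_of y N) => //=; exact: mem_prefixes.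
by apply: (dU z Uz); apply/prefix_ofP; rewrite zp.
Qed.

Lemma cells_determined N (D : {set prefix N}) :
  determined [set y | prefix_of y N \in D] N.
Proof. by move=> y /= yD z /prefix_ofP /= ->. Qed.

Lemma prefixes_sub U N (D : {set prefix N}) : D \subset prefixes U N ->
  prefixes [set y | prefix_of y N \in D] N = D.
Proof.
move=> /fintype.subsetP DU; apply/setP => p; apply/prefixesP/idP => [[y /= yD <-]//|pD].
by have /prefixesP[y _ yp] := DU _ pD; exists y => //=; rewrite yp.
Qed.

Lemma cells_sub U N (D : {set prefix N}) : determined U N -> D \subset prefixes U N ->
  [set y | prefix_of y N \in D] `<=` U.
Proof.
move=> dU /fintype.subsetP DU y /= /DU /prefixesP[z Uz zy].
by apply: (dU z Uz); apply/prefix_ofP.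
Qed.

Lemma mem_prefixesS U N (p : prefix N) (l : 'I_label_bound.+1) (j : vertex B) :
  determined U N ->
  ((p, l, j) : prefix N.+1) \in prefixes U N.+1 =
  (p \in prefixes U N) && (l < incidence B j (prefix_end p))%N.
Proof.
move=> dU; apply/prefixesP/andP => [[y Uy [yp yl yj]]|[/prefixesP[y Uy yp] lj]].
  split; first by apply/prefixesP; exists y.
  by rewrite -yp -yl -yj prefix_end_of inordK ?label_lt//; exact: path_edge.
rewrite -yp prefix_end_of in lj.
have [z [yz zl zj]] := path_extension lj.
exists z; first exact: dU yz.
by rewrite /= zl zj inord_val; congr (_, _, _); rewrite -yp; apply/prefix_ofP.
Qed.

(** This is the action of A, the transpose of the incidence matrix, on column vectors. *)
Definition edge_sum (R : nzRingType) (phi : vertex B -> R) (i : vertex B) : R :=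
  \sum_(j : vertex B) (incidence B j i)%:R * phi j.

(** A prefix ending in [i] has [incidence B j i] extensions ending in [j]. With the weights of the
    vertices as [phi] this serves to compute measures; with an indicator it counts cylinders by end
    vertex. *)
Lemma sum_prefixesS (R : nzRingType) U N (phi : vertex B -> R) : determined U N ->
  \sum_(p in prefixes U N.+1) phi (prefix_end p) =
  \sum_(p in prefixes U N) edge_sum phi (prefix_end p).
Proof.
move=> dU.
pose L := 'I_label_bound.+1.
transitivity (\sum_(p in prefixes U N) \sum_(j : vertex B) \sum_(l : L |
    (l < incidence B j (prefix_end p))%N) phi j).
  under [RHS]eq_bigr => p _ do rewrite (exchange_big_dep predT) //=.
  rewrite pair_big_dep /= pair_big_dep /=.
  apply: eq_big => [[[p l] j]|[[p l] j]] //=; by rewrite mem_prefixesS //= andbT.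
apply: eq_bigr => p _; apply: eq_bigr => j _.
rewrite sumr_const mulr_natl; congr (_ *+ _).
have le : (incidence B j (prefix_end p) <= label_bound.+1)%N.
  apply: leqW; apply: leq_trans (leq_bigmax (prefix_end p)).
  exact: (leq_bigmax (F := fun i => incidence B i (prefix_end p))).
by rewrite -sum1_card -[LHS](big_ord_widen _ (fun=> 1%N) le) sum_nat_const card_ord muln1.
Qed.

Lemma sum_prefixesD (R : nzRingType) U N d (phi : vertex B -> R) : determined U N ->
  \sum_(p in prefixes U (N + d)) phi (prefix_end p) =
  \sum_(p in prefixes U N) iter d (@edge_sum R) phi (prefix_end p).
Proof.
move=> dU; elim: d phi => [|d IH] phi; first by rewrite addn0.
rewrite addnS sum_prefixesS; last exact: determined_le (leq_addr _ _) dU.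
by rewrite IH -iterSr.
Qed.

End Paths.

(** * Perron-Frobenius positivity for primitive matrices *)

Section PerronFrobenius.
Variable R : realType.

Lemma pos_lower_bound (T : finType) (f : T -> R) : (forall i, 0 < f i) ->
  exists2 c, 0 < c & forall i, c <= f i.
Proof.
move=> f0; exists (\big[Num.min/1]_i f i) => [|i].
  by apply: lt_bigmin => // i _; exact: f0.
exact: bigmin_le.
Qed.

Variables (n : nat) (A : 'M[R]_n) (x : 'cV[R]_n) (lambda : R).
Hypotheses (A_ge0 : forall i j, 0 <= A i j) (A_prim : primitive A).
Hypotheses (x_gt0 : forall i, 0 < x i 0) (Ax : A *m x = lambda *: x) (lambda_gt0 : 0 < lambda).

Lemma expmxS d : A ^+ d.+1 = A ^+ d *m A.
Proof. exact: exprSr. Qed.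

Lemma expmxD d e : A ^+ (d + e) = A ^+ d *m A ^+ e.
Proof. exact: exprD. Qed.

Lemma expmx_eigen d : A ^+ d *m x = lambda ^+ d *: x.
Proof.
elim: d => [|d IH]; first by rewrite !expr0 mul1mx scale1r.
by rewrite expmxS -mulmxA Ax -scalemxAr IH scalerA exprS.
Qed.

(** Entry [j] can vanish after one more multiplication only if column [j] of [A] is zero; then it is
    zero in every positive power of [A], against primitivity. *)
Lemma primitive_row_pos (w : 'rV[R]_n) d0 : (forall j, 0 < (w *m A ^+ d0) 0 j) ->
  forall d, (d0 <= d)%N -> forall j, 0 < (w *m A ^+ d) 0 j.
Proof.
move=> h d /subnKC <-; elim: (d - d0)%N => [|e IH] j; first by rewrite addn0.
rewrite addnS expmxS mulmxA mxE.
have ge i : 0 <= (w *m A ^+ (d0 + e)) 0 i * A i j by rewrite mulr_ge0// ltW.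
rewrite lt_neqAle sumr_ge0// andbT eq_sym; apply/negP => /eqP.
move/psumr_eq0P => /(_ (fun i _ => ge i)) z.
have [[//|k] _ /(_ j j)] := A_prim.
rewrite expmxS mxE big1 ?ltxx// => i _.
by have /eqP := z i isT; rewrite mulf_eq0 gt_eqF//= => /eqP ->; rewrite mulr0.
Qed.

(* Write [w A^d = lambda^d (p - q)] with [p, q >= 0]. As a power of [A] is
   positive, the common part of the images of [p] and [q] can be cancelled, which
   makes the mass of [q] decay geometrically, while [p - q] keeps its mass. *)
Lemma perron_frobenius_pos (w : 'rV[R]_n) : 0 < (w *m x) 0 0 ->
  exists d0, forall d, (d0 <= d)%N -> forall j, 0 < (w *m A ^+ d) 0 j.
Proof.
move=> s_gt0; set s := (w *m x) 0 0 in s_gt0.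
suff [d0 h] : exists d0, forall j, 0 < (w *m A ^+ d0) 0 j.
  by exists d0; exact: primitive_row_pos.
have [k _ Ak] := A_prim.
pose M := lambda ^- k *: A ^+ k.
have lk_gt0 d : 0 < lambda ^+ d by rewrite exprn_gt0.
have lk0 d : lambda ^+ d != 0 by rewrite gt_eqF.
have Mx : M *m x = x by rewrite -scalemxAl expmx_eigen scalerA mulVf// scale1r.
have M_gt0 i j : 0 < M i j by rewrite mxE mulr_gt0// invr_gt0.
(* The constant [e] satisfies [e * x i 0 <= M i j], so for [p >= 0] every entry of [p *m M] is at
   least [e] times the mass [p *m x]. *)
have [e e_gt0 eM] := @pos_lower_bound _ (fun ij : 'I_n * 'I_n => M ij.1 ij.2 / x ij.1 0)
  (fun ij => divr_gt0 (M_gt0 _ _) (x_gt0 _)).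
have {}eM i j : e * x i 0 <= M i j by rewrite -ler_pdivlMr//; exact: (eM (i, j)).
have M_mass (p : 'rV_n) j : (forall i, 0 <= p 0 i) -> e * (p *m x) 0 0 <= (p *m M) 0 j.
  move=> p0; rewrite !mxE mulr_sumr; apply: ler_sum => i _.
  by rewrite mulrCA ler_wpM2l.
have massB (p q : 'rV_n) : ((p - q) *m x) 0 0 = (p *m x) 0 0 - (q *m x) 0 0.
  by rewrite mulmxBl mxE [X in _ + X]mxE.
have mass_ge0 (p : 'rV_n) : (forall i, 0 <= p 0 i) -> 0 <= (p *m x) 0 0.
  by move=> p0; rewrite mxE sumr_ge0// => i _; rewrite mulr_ge0// ltW.
have [i0 _] : exists i0 : 'I_n, True.
  case: (pselect (exists i0 : 'I_n, True)) => // nI.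
  by move: s_gt0; rewrite /s mxE big1 ?ltxx// => i; exfalso; apply: nI; exists i.
pose X := \sum_i x i 0.
pose one : 'rV[R]_n := const_mx 1.
have oneX : (one *m x) 0 0 = X by rewrite mxE; apply: eq_bigr => i _; rewrite mxE mul1r.
have X_gt0 : 0 < X.
  rewrite /X (bigD1 i0)//= ltr_pwDl// sumr_ge0// => i _; exact: ltW.
have eX : e * X <= 1.
  have := congr1 (fun y : 'cV_n => y i0 0) Mx; rewrite mxE => xE.
  have := x_gt0 i0; move=> xi0; rewrite -(ler_pM2r xi0) mul1r -{2}xE /X mulr_sumr mulr_suml.
  by apply: ler_sum => j _; rewrite mulrAC ler_wpM2r// ltW.
(* Subtracting [e] times the mass of [q] from every entry of [q *m M] leaves [rho] times that
   mass. *)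
pose rho := 1 - e * X.
pose b := \sum_i `|w 0 i| * x i 0.
have decay t : exists d (p q : 'rV[R]_n), [/\ w *m A ^+ d = lambda ^+ d *: (p - q),
    forall i, 0 <= p 0 i, forall i, 0 <= q 0 i, (p *m x) 0 0 - (q *m x) 0 0 = s &
    (q *m x) 0 0 <= b * rho ^+ t].
  elim: t => [|t [d [p [q [wE p0 q0 sE qb]]]]].
    exists 0%N, (\row_i (Num.max (w 0 i) 0)), (\row_i (Num.max (w 0 i) 0) - w); split.
    - by rewrite !expr0 mulmx1 scale1r opprB addrC subrK.
    - by move=> i; rewrite mxE le_max lexx orbT.
    - by move=> i; rewrite !mxE subr_ge0 le_max lexx.
    - by rewrite massB opprB addrC subrK.
    - rewrite expr0 mulr1 /b mxE; apply: ler_sum => i _; rewrite ler_wpM2r ?(ltW (x_gt0 i))// !mxE.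
      by case: (leP (w 0 i) 0) => h; [rewrite add0r -normrN ler_norm|rewrite subrr].
  pose c := e * (q *m x) 0 0.
  have Mc (y : 'rV[R]_n) : ((y *m M - c *: one) *m x) 0 0 = (y *m x) 0 0 - c * X.
    by rewrite massB -mulmxA Mx -scalemxAl [X in _ - X]mxE oneX.
  have cE i : (c *: one) 0 i = c by rewrite !mxE mulr1.
  exists (d + k)%N, (p *m M - c *: one), (q *m M - c *: one); split.
  - rewrite expmxD mulmxA wE opprB addrA subrK.
    rewrite -mulmxBl -scalemxAr scalerA -scalemxAl exprD mulfK//.
  - move=> i; rewrite mxE [X in _ + X]mxE cE subr_ge0; apply: le_trans (M_mass p i p0).
    by rewrite ler_pM2l// -subr_ge0 sE ltW.
  - by move=> i; rewrite mxE [X in _ + X]mxE cE subr_ge0; exact: M_mass.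
  - by rewrite !Mc opprB addrA subrK.
  - rewrite Mc exprS mulrCA /c.
    have -> : (q *m x) 0 0 - e * (q *m x) 0 0 * X = rho * (q *m x) 0 0.
      by rewrite /rho mulrBl mul1r mulrAC.
    by rewrite ler_wpM2l// subr_ge0.
have [c c_gt0 cx] := pos_lower_bound x_gt0.
(* With the mass of [q] this small, entry [j] of [q *m M] is below [e * s], whereas entry [j] of
   [p *m M] is at least [e] times the mass of [p], hence at least [e * s]. *)
have [t bt] : exists t, b * rho ^+ t < e * s * c.
  have rho1 : `|rho| < 1.
    by rewrite ger0_norm ?subr_ge0// ltrBlDr ltrDl mulr_gt0.
  have : b * rho ^+ t @[t --> \oo] --> b * 0 by apply: cvgMl_tmp; exact: cvg_expr.
  rewrite mulr0 => /cvgr_lt/(_ (e * s * c)) [|t _ /(_ t)]; first by rewrite !mulr_gt0.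
  by move=> h; exists t; apply: h => /=.
have [d [p [q [wE p0 q0 sE qb]]]] := decay t.
exists (d + k)%N => j.
rewrite expmxD mulmxA wE.
have -> : A ^+ k = lambda ^+ k *: M by rewrite scalerA mulfV// scale1r.
rewrite -scalemxAr -scalemxAl scalerA mxE mulr_gt0 ?mulr_gt0// mulmxBl mxE [X in _ + X]mxE subr_gt0.
have qM0 i : 0 <= (q *m M) 0 i by rewrite mxE sumr_ge0// => l _; rewrite mulr_ge0// ltW.
have qj : (q *m M) 0 j * x j 0 <= (q *m x) 0 0.
  rewrite -{2}Mx mulmxA [leRHS]mxE (bigD1 j)//= lerDl sumr_ge0// => i _.
  by rewrite mulr_ge0// ltW.
rewrite -(ltr_pM2r (x_gt0 j)); apply: le_lt_trans qj _; apply: le_lt_trans qb _.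
apply: lt_le_trans bt _; apply: ler_pM; rewrite ?mulr_ge0 ?(ltW s_gt0) ?(ltW e_gt0) ?(ltW c_gt0)//.
apply: le_trans (M_mass p j p0); rewrite ler_pM2l// -sE gerDl oppr_le0.
exact: mass_ge0.
Qed.

End PerronFrobenius.

(** * Additive subgroups and greatest common divisors *)

Section Gcd.
Variables (V : zmodType) (P : set V).
Hypotheses (P0 : P 0) (PB : forall u w, P u -> P w -> P (u - w)).

Lemma closed_mulrn u k : P u -> P (u *+ k).
Proof.
move=> Pu; elim: k => [//|k IH].
have -> : u *+ k.+1 = u - (0 - u *+ k) by rewrite sub0r opprK mulrS.
by apply: (PB Pu); exact: PB.
Qed.

(** Bezout's identity with natural coefficients, [ka * a = kb * b + gcdn a b]. *)
Lemma closed_mulrn_gcd u a b : P (u *+ a) -> P (u *+ b) -> P (u *+ gcdn a b).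
Proof.
case: (posnP a) => [->|a_gt0]; first by rewrite gcd0n.
move=> Pa Pb; case: (egcdnP b a_gt0) => ka kb kE _.
have -> : u *+ gcdn a b = u *+ a *+ ka - u *+ b *+ kb.
  by rewrite -!mulrnA [(a * ka)%N]mulnC kE mulrnDr [(b * kb)%N]mulnC addrAC subrr add0r.
by apply: PB; exact: closed_mulrn.
Qed.

Lemma closed_mulrn_biggcd (I : finType) (Q : pred I) (p : I -> nat) u :
  (forall i, Q i -> P (u *+ p i)) -> P (u *+ \big[gcdn/0%N]_(i | Q i) p i).
Proof. by move=> hp; elim/big_ind: _ => // a b; exact: closed_mulrn_gcd. Qed.

End Gcd.

Section AddGroup.
Variables (V : zmodType) (S : set V).

Lemma addgroup_genS u : S u -> addgroup_gen S u.
Proof. exact: sub_gen_smallest. Qed.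

Lemma addgroup_gen_closed : zmod_closed [pred u | u \in addgroup_gen S].
Proof.
split=> [|u w]; rewrite !inE.
  by move=> H [[h0 _] _]; rewrite inE in h0.
move=> hu hw H [hz SH]; have [_ /(_ u w)] := hz.
by rewrite !inE; apply; [apply: hu | apply: hw].
Qed.

Lemma addgroup_gen0 : addgroup_gen S 0.
Proof. by have [] := addgroup_gen_closed; rewrite inE. Qed.

Lemma addgroup_genB u w : addgroup_gen S u -> addgroup_gen S w -> addgroup_gen S (u - w).
Proof.
by have [_ /(_ u w)] := addgroup_gen_closed; rewrite !inE; apply.
Qed.

Lemma addgroup_genN u : addgroup_gen S u -> addgroup_gen S (- u).
Proof. by rewrite -sub0r; apply: addgroup_genB; exact: addgroup_gen0. Qed.

Lemma addgroup_genD u w : addgroup_gen S u -> addgroup_gen S w -> addgroup_gen S (u + w).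
Proof. by move=> hu /addgroup_genN; rewrite -{2}[w]opprK; exact: addgroup_genB. Qed.

Lemma addgroup_gen_sum (I : Type) (r : seq I) (P : pred I) (F : I -> V) :
  (forall i, P i -> addgroup_gen S (F i)) -> addgroup_gen S (\sum_(i <- r | P i) F i).
Proof.
by move=> h; elim/big_ind: _ => //; [exact: addgroup_gen0 | exact: addgroup_genD].
Qed.

Lemma addgroup_genMn u k : addgroup_gen S u -> addgroup_gen S (u *+ k).
Proof. by apply: closed_mulrn; [exact: addgroup_gen0|exact: addgroup_genB]. Qed.

Lemma addgroup_gen_ind (P : set V) : P 0 -> (forall u w, P u -> P w -> P (u - w)) ->
  S `<=` P -> addgroup_gen S `<=` P.
Proof.
move=> P0 PB SP; apply: smallest_sub => //; split=> [|u w]; rewrite !inE //; exact: PB.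
Qed.

End AddGroup.

Lemma addgroup_gen_sub (V : zmodType) (S S' : set V) : S `<=` S' ->
  addgroup_gen S `<=` addgroup_gen S'.
Proof.
move=> SS'; apply: addgroup_gen_ind; [exact: addgroup_gen0|exact: addgroup_genB|].
by move=> u /SS'; exact: addgroup_genS.
Qed.

Lemma addgroup_gen_coords (R : realType) (I : finType) (f : I -> R) u :
  addgroup_gen (range f) u -> exists z : I -> int, u = \sum_i (z i)%:~R * f i.
Proof.
move: u; apply: addgroup_gen_ind.
- by exists (fun=> 0); rewrite big1// => i _; rewrite mul0r.
- move=> _ _ [y ->] [z ->]; exists (fun i => y i - z i); rewrite -sumrB.
  by apply: eq_bigr => i _; rewrite rmorphB mulrBl.
- move=> _ [i _ <-]; exists (fun j => (j == i)%:Z).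
  rewrite (bigD1 i)//= eqxx mul1r big1 ?addr0// => j /negbTE ->.
  by rewrite mul0r.
Qed.

(** * Measures of clopen sets and of their parts inside [alpha] *)

Section Measure.
Variables (R : realType) (B : stationary_diagram).
Variable mu : {measure set (borel_paths B) -> \bar R}.
Implicit Types (x y : bpath B) (U V : set (borel_paths B)) (k N d : nat).

Lemma open_measurable_paths U : open (U : set (bpath B)) -> measurable U.
Proof. exact: sub_sigma_algebra. Qed.

Lemma determined_measurable U N : determined U N -> measurable U.
Proof. by move=> /determined_clopen[oU _]; exact: open_measurable_paths. Qed.

(** The set [A] is the whole space when [mu U] itself is computed, and [stays] when only the part
    inside [alpha] is. *)
Lemma measure_cells U N (A : set (borel_paths B)) : determined U N -> measurable A ->
  mu (U `&` A) = (\sum_(q in prefixes U N) mu (cell q `&` A))%E.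
Proof.
move=> dU mA; rewrite [X in mu (X `&` A)](determined_cells dU) setI_bigcupl.
have -> : [set` prefixes U N] = [set` enum (prefixes U N)].
  by rewrite predeqE => q /=; rewrite mem_enum.
rewrite measure_fin_bigcup //.
- by rewrite -fsbig_seq ?enum_uniq// big_enum.
- by move=> q q' _ _ [y [[yq _] [yq' _]]]; rewrite -yq -yq'.
- move=> q _; apply: measurableI => //.
  by apply: (@determined_measurable _ N) => y <- z /prefix_ofP.
Qed.

Section Class.
Variables (alpha : {set vertex B}) (lambda : R).
Hypotheses (alpha_closed : forall i j, i \in alpha -> (0 < incidence B j i)%N -> j \in alpha).
Hypotheses (lambda_gt0 : 0 < lambda).

Definition stays k : set (borel_paths B) := [set y | forall j, (k <= j)%N -> vert y j \in alpha].

(** No edge leaves [alpha], so one vertex decides the future; this makes [stays k] clopen. *)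
Lemma staysE k : stays k = [set y | vert y k \in alpha].
Proof.
rewrite predeqE => y; split=> [|yk j /subnKC <-]; first exact.
elim: (j - k)%N => [|e IH]; first by rewrite addn0.
rewrite addnS; apply: alpha_closed IH _; exact: leq_trans (path_edge _ _).
Qed.

Lemma stays_determined k : determined (stays k) k.
Proof. by rewrite staysE => y yk z [zy _]; rewrite /= zy. Qed.

Hypothesis mu_alpha : mu (~` eventually_in alpha) = 0%E.

(** Up to a null set the space is the increasing union of the sets [stays N], so continuity from
    below applies. *)
Lemma le_measure_stays U (c : \bar R) : measurable U ->
  (forall N, (mu (U `&` stays N) <= c)%E) -> (mu U <= c)%E.
Proof.
move=> mU hc.
have mS N : measurable (U `&` stays N).
  by apply: measurableI => //; exact: determined_measurable (@stays_determined N).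
have evE : (eventually_in alpha : set (borel_paths B)) = \bigcup_N stays N.
  by rewrite predeqE => y; split=> [[N yN]|[N _ yN]]; exists N.
have mev : measurable (eventually_in alpha : set (borel_paths B)).
  rewrite evE; apply: bigcupT_measurable => N.
  exact: determined_measurable (@stays_determined N).
rewrite (measureDI mu mU mev) [X in (X + _)%E](_ : _ = 0%E) ?add0e; last first.
  apply: (subset_measure0 _ _ _ mu_alpha); [exact: measurableD|exact: measurableC|].
  by move=> y [].
rewrite evE setI_bigcupr.
have := @nondecreasing_cvg_mu _ _ _ mu (fun N => U `&` stays N) mS (bigcupT_measurable _ mS).
set F := (mu \o _) => cvgF.
have {}cvgF : F N @[N --> \oo] --> mu (\bigcup_N (U `&` stays N)).
  apply: cvgF => N M NM; apply/subsetPset => y [Uy yN]; split=> // j Mj.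
  by apply: yN; exact: leq_trans Mj.
by apply: (cvge_to_le cvgF); apply: nearW => N; exact: hc.
Qed.

Variable a : vertex B -> R.
Hypothesis a_ge0 : forall i, 0 <= a i.
Hypothesis mu_a : forall x k, mu (cylinder x k `&` stays k) = (a (vert x k) / lambda ^+ k)%:E.

(** Divided by [lambda ^+ k], this is the measure of the paths in a cylinder ending in [i] at index
    [k] that are in [alpha] from index [k + d] on. *)
Definition stay_mass d i := iter d (@edge_sum B R) a i / lambda ^+ d.

Lemma measure_cylinder_stays x k d :
  mu (cylinder x k `&` stays (k + d)) = (stay_mass d (vert x k) / lambda ^+ k)%:E.
Proof.
have dC : determined (cylinder x k) k by move=> y xy z; exact: cylinder_trans.
rewrite (measure_cells (determined_le (leq_addr d k) dC)); last first.
  exact: determined_measurable (@stays_determined _).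
transitivity ((\sum_(q in prefixes (cylinder x k) (k + d)) a (prefix_end q))
  / lambda ^+ (k + d))%:E.
  rewrite mulr_suml -sumEFin; apply: eq_bigr => q /prefixesP[y _ <-].
  by rewrite cell_prefix_of mu_a prefix_end_of.
rewrite sum_prefixesD// (_ : prefixes _ _ = [set prefix_of x k]%SET); last first.
  apply/setP => q; rewrite inE; apply/prefixesP/eqP => [[y xy <-]|->]; first exact/prefix_ofP.
  by exists x.
by rewrite big_set1 prefix_end_of /stay_mass exprD invfM mulrA mulrAC.
Qed.

Definition bounded_mass i := exists C, forall d, stay_mass d i <= C.

(** The parts in [stays (k + d)] exhaust the cylinder up to a null set, and up to the factor
    [lambda ^+ k] their measures depend only on the end vertex. *)
Lemma finite_cylinderP x k : (mu (cylinder x k) < +oo)%E <-> bounded_mass (vert x k).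
Proof.
have lk0 : 0 < lambda ^+ k by rewrite exprn_gt0.
have mC : measurable (cylinder x k : set (borel_paths B)).
  exact: (open_measurable_paths (open_cylinder _ _)).
split=> [fin|[C hC]].
  exists (fine (mu (cylinder x k)) * lambda ^+ k) => d; rewrite -ler_pdivrMr// -lee_fin.
  rewrite -measure_cylinder_stays fineK ?ge0_fin_numE ?measure_ge0//.
  apply: le_measure; rewrite ?inE//; apply: measurableI => //.
  exact: determined_measurable (@stays_determined _).
apply: (@le_lt_trans _ _ (C / lambda ^+ k)%:E); last exact: ltry.
apply: le_measure_stays => // N.
apply: (@le_trans _ _ (mu (cylinder x k `&` stays (k + N)))).
  apply: le_measure; rewrite ?inE; [| |].
  - by apply: measurableI => //; exact: determined_measurable (@stays_determined _).
  - by apply: measurableI => //; exact: determined_measurable (@stays_determined _).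
  - move=> y [xy yN]; split=> // j kNj; apply: yN; apply: leq_trans kNj; exact: leq_addl.
by rewrite measure_cylinder_stays lee_fin ler_pM2r ?invr_gt0.
Qed.

(** An edge from [i] to [u] makes [u] a term of the [edge_sum] at [i], whence [stay_mass d u <=
    lambda * stay_mass d.+1 i]; bounds thus travel along paths. *)
Lemma bounded_mass_connect i j : connect (@edge_rel B) i j -> bounded_mass i -> bounded_mass j.
Proof.
move=> /connectP[s]; elim: s i => [i _ ->//|u s IH i /= /andP[iu us] jl [C hC]].
apply: IH us jl _; exists (lambda * C) => d.
have it0 e v : 0 <= iter e (@edge_sum B R) a v.
  by elim: e v => [//|e IHe] v /=; rewrite sumr_ge0// => v' _; rewrite mulr_ge0.
rewrite -ler_pdivrMl//; apply: le_trans (hC d.+1).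
rewrite /stay_mass iterS exprS invfM [leRHS]mulrCA.
rewrite ler_wpM2l ?invr_ge0 ?(ltW lambda_gt0)// ler_wpM2r ?invr_ge0 ?exprn_ge0 ?(ltW lambda_gt0)//.
rewrite /edge_sum (bigD1 u)//= -[leLHS]addr0 lerD//.
  by rewrite -[leLHS]mul1r ler_wpM2r// ler1n.
by rewrite sumr_ge0// => v' _; rewrite mulr_ge0.
Qed.

End Class.

Definition finite_end i := exists y k, vert y k = i /\ (mu (cylinder y k) < +oo)%E.

(** * Goodness and the group generated by the weights of [alpha] *)

Section Good.
Variables (alpha : {set vertex B}) (lambda : R).
Hypotheses (alpha_closed : forall i j, i \in alpha -> (0 < incidence B j i)%N -> j \in alpha).
Hypothesis mu_alpha : mu (~` eventually_in alpha) = 0%E.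
Hypothesis lambda_gt1 : 1 < lambda.
Hypothesis alpha_prim : primitive (block R alpha).
Variables (i0 : vertex B) (alpha_i0 : i0 \in alpha).
Variable X : vertex B -> R.
Hypothesis X_gt0 : forall i, i \in alpha -> 0 < X i.
Hypothesis X_eigen : forall i, i \in alpha -> edge_sum X i = lambda * X i.
Hypothesis X_alpha : forall y k, vert y k \in alpha ->
  mu (cylinder y k) = (X (vert y k) / lambda ^+ k)%:E.

Hypothesis X_fin : forall i, finite_end i -> forall y k, vert y k = i ->
  mu (cylinder y k) = (X i / lambda ^+ k)%:E.

Local Notation H := (addgroup_gen [set X j | j in [set` alpha]]).
Local Notation A := (block R alpha).

Let lambda_gt0 : 0 < lambda. Proof. exact: lt_trans lambda_gt1. Qed.
Let lambdaX_gt0 k : 0 < lambda ^+ k. Proof. by rewrite exprn_gt0. Qed.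
Let lambdaX_neq0 k : lambda ^+ k != 0. Proof. by rewrite gt_eqF. Qed.

Lemma measure_determined U N : determined U N ->
  (forall y, U y -> mu (cylinder y N) = (X (vert y N) / lambda ^+ N)%:E) ->
  mu U = ((\sum_(q in prefixes U N) X (prefix_end q)) / lambda ^+ N)%:E.
Proof.
move=> dU hU; rewrite -[X in mu X](setIT U) (measure_cells dU)// mulr_suml -sumEFin.
apply: eq_bigr => q /prefixesP[y Uy <-].
by rewrite setIT cell_prefix_of prefix_end_of hU.
Qed.

Lemma measure_finite U N : determined U N -> (mu U < +oo)%E ->
  mu U = ((\sum_(q in prefixes U N) X (prefix_end q)) / lambda ^+ N)%:E.
Proof.
move=> dU fU; apply: measure_determined => // y Uy; apply: X_fin => //; exists y, N; split=> //.
apply: le_lt_trans fU; apply: le_measure; rewrite ?inE; last exact: dU.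
- exact: (open_measurable_paths (open_cylinder _ _)).
- exact: determined_measurable dU.
Qed.

Lemma measure_in_alpha U N : determined U N -> (forall y, U y -> vert y N \in alpha) ->
  mu U = ((\sum_(q in prefixes U N) X (prefix_end q)) / lambda ^+ N)%:E.
Proof. by move=> dU hU; apply: measure_determined => // y /hU; exact: X_alpha. Qed.

Lemma vert_in_alpha_le y k N : (k <= N)%N -> vert y k \in alpha -> vert y N \in alpha.
Proof.
by move=> kN yk; have := staysE alpha_closed k; rewrite predeqE => /(_ y)[_ /(_ yk)]; apply.
Qed.

(** The eigenvector equation writes [lambda * X j] as a natural combination of weights of successors
    of [j], all of them in [alpha]. *)
Lemma group_lambda u k : H u -> H (lambda ^+ k * u).
Proof.
elim: k u => [|k IH] u Hu; first by rewrite mul1r.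
rewrite exprSr -mulrA; apply: IH; move: u Hu; apply: addgroup_gen_ind.
- by rewrite mulr0; exact: addgroup_gen0.
- by move=> u w Hu Hw; rewrite mulrBr; exact: addgroup_genB.
move=> _ [j /= ja <-]; rewrite -X_eigen//; apply: addgroup_gen_sum => i _.
case: (posnP (incidence B i j)) => [->|ij]; first by rewrite mul0r; exact: addgroup_gen0.
rewrite mulr_natl; apply: addgroup_genMn; apply: addgroup_genS.
by exists i => //=; exact: alpha_closed ij.
Qed.

Lemma inv_lambda_lt (u e : R) : 0 < e -> exists k, u / lambda ^+ k < e.
Proof.
move=> e_gt0; have l1 : `|lambda^-1| < 1.
  by rewrite ger0_norm ?invr_ge0 ?ltW// invf_lt1.
have : u * lambda^-1 ^+ k @[k --> \oo] --> u * 0 by apply: cvgMl_tmp; exact: cvg_expr.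
rewrite mulr0 => /cvgr_lt/(_ e e_gt0)[k _ /(_ k)] h.
by exists k; rewrite -exprVn; apply: h => /=.
Qed.

Lemma good_group i : good mu -> finite_end i -> exists r, H (lambda ^+ r * X i).
Proof.
move=> gd [y [k [yi fy]]].
have [y0 y0i] := path_through i0 0.
(* A cylinder ending in [i] is taken so far down that it weighs less than a first-level cylinder
   ending in [i0]; goodness then finds its measure inside the latter. *)
have [N XN] := inv_lambda_lt (X i) (X_gt0 alpha_i0).
have [z zi] := path_through i N.
have muU : mu (cylinder z N) = (X i / lambda ^+ N)%:E by apply: X_fin => //; exists y, k.
have muV : mu (cylinder y0 0) = (X i0)%:E by rewrite X_alpha y0i// expr0 divr1.
have det y' k' : determined (cylinder y' k') k' by move=> t h u; exact: cylinder_trans.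
have [|W [/clopen_determined[M dW] WV WE]] :=
    gd _ _ (determined_clopen (det z N)) (determined_clopen (det y0 0%N)).
  by rewrite muU muV lte_fin.
(* At index [M + N] a factor [lambda ^+ N] cancels against the denominator of the measure of
   [cylinder z N], which leaves [lambda ^+ M * X i]. *)
have {}dW : determined W (M + N) by apply: determined_le dW; exact: leq_addr.
have /(measure_in_alpha dW) : forall y, W y -> vert y (M + N) \in alpha.
  by move=> u /WV[u0 _]; apply: (@vert_in_alpha_le _ 0) => //; rewrite u0 y0i.
rewrite WE muU exprD invfM mulrA => -[] /(congr1 (fun u => u * lambda ^+ N)).
rewrite !mulfVK// => XE; exists M; rewrite XE mulrC mulfVK//.
apply: addgroup_gen_sum => q /prefixesP[u /WV[u0 _] <-]; apply: addgroup_genS.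
rewrite prefix_end_of; exists (vert u (M + N)) => //=.
by apply: (@vert_in_alpha_le _ 0) => //; rewrite u0 y0i.
Qed.

(** There are finitely many vertices, and [group_lambda] lets every exponent be raised to the
    maximum. *)
Lemma good_group_uniform : good mu -> exists r, forall i, finite_end i -> H (lambda ^+ r * X i).
Proof.
move=> gd.
have hc i : exists r, finite_end i -> H (lambda ^+ r * X i).
  case: (pselect (finite_end i)) => [/(good_group gd)[r hr]|nf]; first by exists r.
  by exists 0%N.
have [f fP] := choice hc.
exists (\max_i f i)%N => i /fP Hi.
by rewrite -(subnK (leq_bigmax i : (f i <= \max_i f i)%N)) exprD -mulrA; exact: group_lambda.
Qed.

Definition class_col (phi : vertex B -> R) : 'cV[R]_#|alpha| := \col_i phi (enum_val i).

Lemma sum_by_end k (D : {set prefix B k}) (phi : vertex B -> R) :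
  (forall q, q \in D -> prefix_end q \in alpha) ->
  \sum_(q in D) phi (prefix_end q) =
  \sum_(i < #|alpha|) #|[set q in D | prefix_end q == enum_val i]|%:R * phi (enum_val i).
Proof.
move=> hD; rewrite (partition_big (@prefix_end B k) (mem alpha))//= big_enum_val.
apply: eq_bigr => i _; rewrite mulr_natl -sumr_const.
by apply: eq_big => [q|q /andP[_ /eqP->]//]; rewrite inE.
Qed.

(** Terms outside [alpha] vanish because no edge leaves [alpha], so the operator of the whole
    diagram acts on [alpha] as its block. *)
Lemma class_col_edge_sum d phi : class_col (iter d (@edge_sum B R) phi) = A ^+ d *m class_col phi.
Proof.
elim: d phi => [|d IH] phi; first by rewrite expr0 mul1mx.
rewrite iterSr IH expmxS -mulmxA; congr (_ *m _).
apply/colP => i; rewrite !mxE /edge_sum.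
rewrite [LHS](bigID (mem alpha)) /= [X in _ + X]big1 ?addr0; last first.
  move=> j ja; case: (posnP (incidence B j (enum_val i))) => [->|ij]; first by rewrite mul0r.
  by rewrite (alpha_closed (enum_valP i) ij) in ja.
by rewrite big_enum_val; apply: eq_bigr => j _; rewrite !mxE.
Qed.

Lemma int_row_step (z : 'I_#|alpha| -> int) d : exists z' : 'I_#|alpha| -> int,
  (\row_i (z i)%:~R) *m A ^+ d = \row_i (z' i)%:~R.
Proof.
elim: d => [|d [z' IH]]; first by exists z; rewrite expr0 mulmx1.
exists (fun j => \sum_i z' i * (incidence B (enum_val j) (enum_val i))%:Z).
rewrite expmxS mulmxA IH; apply/rowP => j; rewrite !mxE rmorph_sum.
by apply: eq_bigr => i _; rewrite !mxE rmorphM.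
Qed.

Lemma subset_of_card (T : finType) (D : {set T}) n : (n <= #|D|)%N ->
  exists2 D' : {set T}, D' \subset D & #|D'| = n.
Proof.
move=> nD; exists [set x in take n (enum D)]%SET.
  by apply/fintype.subsetP => x; rewrite inE => /mem_take; rewrite mem_enum.
rewrite cardsE (card_uniqP _) ?take_uniq ?enum_uniq// size_take_min -cardE.
exact/minn_idPl.
Qed.

(** The vector [z] may have negative entries, or entries larger than the supply of cylinders in [V];
    [d] levels further its image is a feasible list of numbers of cylinders. *)
Lemma clopen_subset_of_vector V K (z : 'I_#|alpha| -> int) :
  determined V K -> (forall y, V y -> vert y K \in alpha) ->
  let s := \sum_(i < #|alpha|) (z i)%:~R * X (enum_val i) in
  0 < s -> ((s / lambda ^+ K)%:E < mu V)%E ->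
  exists W : set (bpath B), [/\ clopen W, W `<=` V & mu W = (s / lambda ^+ K)%:E].
Proof.
move=> dV aV s s_gt0; rewrite (measure_in_alpha dV aV) lte_fin ltr_pM2r ?invr_gt0// => sV.
have endV d q : q \in prefixes V (K + d) -> prefix_end q \in alpha.
  move=> /prefixesP[y Vy <-]; rewrite prefix_end_of.
  by apply: vert_in_alpha_le (aV _ Vy); exact: leq_addr.
pose cnt d (i : 'I_#|alpha|) := #|[set q in prefixes V (K + d) | prefix_end q == enum_val i]|.
pose x := class_col X.
have Ax : A *m x = lambda *: x.
  rewrite -[A in LHS]expr1 -class_col_edge_sum; apply/colP => i.
  by rewrite !mxE /= X_eigen ?enum_valP.
pose c : 'rV[R]_#|alpha| := \row_i #|[set q in prefixes V K | prefix_end q == enum_val i]|%:R.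
pose u : 'rV[R]_#|alpha| := \row_i (z i)%:~R.
have ux : (u *m x) 0 0 = s by rewrite mxE; apply: eq_bigr => i _; rewrite !mxE.
have sumV phi : \sum_(q in prefixes V K) phi (prefix_end q) = (c *m class_col phi) 0 0.
  rewrite sum_by_end; last by move=> q /prefixesP[y Vy <-]; rewrite prefix_end_of; exact: aV.
  by rewrite mxE; apply: eq_bigr => i _; rewrite !mxE.
have cA d j : (c *m A ^+ d) 0 j = (cnt d j)%:R.
  (* The indicator of the vertex turns the summation formula for [d] levels into a count. *)
  transitivity (\sum_(q in prefixes V (K + d)) (prefix_end q == enum_val j)%:R : R).
    rewrite (sum_prefixesD _ (fun i => (i == enum_val j)%:R)) // sumV class_col_edge_sum mulmxA.
    rewrite [RHS]mxE (bigD1 j)//= [X in _ * X]mxE eqxx mulr1 big1 ?addr0// => i ij.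
    by rewrite [X in _ * X]mxE (inj_eq enum_val_inj) (negbTE ij) mulr0.
  rewrite -natr_sum /cnt -sum1_card; congr (_%:R).
  rewrite big_mkcond [RHS]big_mkcond; apply: eq_bigr => q _; rewrite inE.
  by case: (q \in _) => //=; case: eqP.
have A_ge0 i j : 0 <= A i j by rewrite !mxE.
have x_gt0 i : 0 < x i 0 by rewrite mxE X_gt0 ?enum_valP.
have pf := perron_frobenius_pos A_ge0 alpha_prim x_gt0 Ax lambda_gt0.
have [d1 u_pos] := pf u (eq_ind_r (fun t => 0 < t) s_gt0 ux).
have [|d2 cu_pos] := pf (c - u).
  rewrite mulmxBl mxE [X in _ + X]mxE ux subr_gt0.
  by rewrite -[(c *m x) 0 0]sumV.
(* Both positivity statements persist beyond their thresholds, so the sum serves for both. *)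
pose d := (d1 + d2)%N.
have [z' zE] := int_row_step z d.
have z'_gt0 j : 0 < z' j.
  by have := u_pos d (leq_addr _ _) j; rewrite zE mxE ltr0z.
have z'_le j : (`|z' j| <= cnt d j)%N.
  have := cu_pos d (leq_addl _ _) j; rewrite mulmxBl mxE [X in _ + X]mxE cA zE mxE subr_gt0.
  rewrite -[z' j]gez0_abs ?(ltW (z'_gt0 j))// -pmulrn ltr_nat; exact: ltnW.
have hc j := subset_of_card (z'_le j).
have [D DP] := choice (fun j => let: ex_intro2 D h1 h2 := hc j in ex_intro _ D (conj h1 h2)).
pose E : {set prefix B (K + d)} := (\bigcup_j D j)%SET.
have DE j q : q \in D j -> (q \in prefixes V (K + d)) && (prefix_end q == enum_val j).
  by have [/fintype.subsetP/(_ q) + _] := DP j; rewrite inE => h /h.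
have EV : E \subset prefixes V (K + d).
  by apply/bigcupsP => j _; apply/fintype.subsetP => q /DE/andP[].
(* The sets [D j] differ in their end vertex, so their union keeps each count. *)
have E_end j : [set q in E | prefix_end q == enum_val j]%SET = D j.
  apply/setP => q; rewrite inE; apply/andP/idP => [[/bigcupP[j' _ qj'] /eqP qj]|qj].
    have /andP[_ /eqP] := DE _ _ qj'; rewrite qj => /enum_val_inj ->//.
  by have /andP[_ ->] := DE _ _ qj; split=> //; apply/bigcupP; exists j.
have dVd : determined V (K + d) by apply: determined_le dV; exact: leq_addr.
have dW := @cells_determined B _ E.
have WV : [set y | prefix_of y (K + d) \in E] `<=` V := cells_sub dVd EV.
exists [set y | prefix_of y (K + d) \in E]; split => //; first exact: determined_clopen dW.
rewrite (measure_in_alpha dW) ?(prefixes_sub EV)//; last first.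
  by move=> y /WV Vy; apply: vert_in_alpha_le (aV _ Vy); exact: leq_addr.
rewrite sum_by_end; last by move=> q /(fintype.subsetP EV); exact: endV.
(* The counts form the row [u *m A ^+ d], and [A ^+ d] multiplies [x] by [lambda ^+ d], which
   compensates for the [d] extra levels. *)
have -> : \sum_(i < #|alpha|) #|[set q in E | prefix_end q == enum_val i]|%:R * X (enum_val i)
    = lambda ^+ d * s.
  rewrite -ux -[lambda ^+ d * _]/(_ *: (u *m x) 0 0).
  have -> : lambda ^+ d *: (u *m x) 0 0 = (u *m A ^+ d *m x) 0 0.
    by rewrite -mulmxA (expmx_eigen Ax) -scalemxAr [RHS]mxE.
  rewrite zE mxE; apply: eq_bigr => i _; rewrite E_end (DP i).2 !mxE.
  by rewrite -[z' i in RHS]gez0_abs ?(ltW (z'_gt0 i)).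
by congr (_%:E); rewrite addnC exprD invfM mulrACA mulfV// mul1r.
Qed.

Lemma group_good r : (forall i, finite_end i -> H (lambda ^+ r * X i)) -> good mu.
Proof.
move=> hr U V cU cV UV.
have [NU dU] := clopen_determined cU; have [NV dV] := clopen_determined cV.
have fU : (mu U < +oo)%E by apply: lt_le_trans UV _; exact: leey.
have muU := measure_finite dU fU.
(* If all the parts of [V] in the sets [stays alpha N] had measure at most [mu U], so would [V]. *)
have [N UN] : exists N, (mu U < mu (V `&` stays alpha N))%E.
  apply: contrapT => nN; have := UV; rewrite ltNge => /negP; apply.
  apply: (le_measure_stays alpha_closed mu_alpha); first exact: determined_measurable dV.
  by move=> N; rewrite leNgt; apply/negP => h; apply: nN; exists N.
(* At this index both [U] and the shrunken [V] are determined, and it exceeds [NU] by at least the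
   [r] that the hypothesis on the weights requires. *)
pose K := (NU + (r + (NV + N)))%N.
have dV' : determined (V `&` stays alpha N) K.
  move=> y [Vy yN] z yz; split.
    by apply: (determined_le _ dV Vy yz); rewrite /K !addnA -addnA addnCA leq_addr.
  apply: (determined_le _ (stays_determined alpha_closed (k := N)) yN yz).
  by rewrite /K !addnA leq_addl.
have aV' y : (V `&` stays alpha N) y -> vert y K \in alpha.
  by move=> [_]; apply; rewrite /K !addnA leq_addl.
have HU : H (lambda ^+ K * fine (mu U)).
  rewrite muU /= /K exprD mulrC mulrA mulfVK// mulrC.
  rewrite addnC exprD -mulrA; apply: group_lambda; rewrite mulr_sumr.
  apply: addgroup_gen_sum => q /prefixesP[y Uy <-]; rewrite prefix_end_of.
  apply: hr; exists y, NU; split => //.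
  apply: le_lt_trans fU; apply: le_measure; rewrite ?inE; last exact: dU.
  - exact: (open_measurable_paths (open_cylinder _ _)).
  - exact: determined_measurable dU.
have [z zE] : exists z : 'I_#|alpha| -> int,
    lambda ^+ K * fine (mu U) = \sum_(i < #|alpha|) (z i)%:~R * X (enum_val i).
  apply: addgroup_gen_coords; move: HU; apply: addgroup_gen_sub => _ [j /= ja <-].
  by exists (enum_rank_in ja j) => //; rewrite enum_rankK_in.
have muUE : mu U = ((\sum_(i < #|alpha|) (z i)%:~R * X (enum_val i)) / lambda ^+ K)%:E.
  by rewrite -zE mulrC mulKf// fineK// ge0_fin_numE.
(* The sum is [lambda ^+ K] times the measure of [U]; if it is not positive, [U] is null and the
   empty set serves as [W]. *)
case: (ltP 0 (\sum_(i < #|alpha|) (z i)%:~R * X (enum_val i))) => s0.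
  have [|W [cW WV WE]] := clopen_subset_of_vector dV' aV' s0; first by rewrite -muUE.
  by exists W; split; [|move=> y /WV[]|rewrite muUE].
exists set0; split => //; first by split; [exact: open0|exact: closed0].
rewrite measure0; apply/esym/eqP; rewrite eq_le measure_ge0 andbT muUE lee_fin.
by rewrite pmulr_lle0// invr_gt0.
Qed.

End Good.

End Measure.

(** * Vertex classes and the support of the measure *)

Section Support.
Variables (R : realType) (B : stationary_diagram).
Variables (alpha : {set vertex B}).
Hypothesis halpha : vertex_class alpha.

Lemma vertex_class_connect (beta : {set vertex B}) i j :
  vertex_class beta -> i \in beta -> j \in beta -> connect (@edge_rel B) i j.
Proof.
by move=> [w ->]; rewrite !inE => /andP[_ iw] /andP[wj _]; exact: connect_trans wj.
Qed.

Lemma mem_vertex_class i j : i \in alpha -> connect (@edge_rel B) i j ->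
  connect (@edge_rel B) j i -> j \in alpha.
Proof.
case: halpha => w ->; rewrite !inE => /andP[wi iw] ij ji.
by rewrite (connect_trans wi ij) (connect_trans ji iw).
Qed.

(** Every vertex leads to [alpha], so an edge leaving [alpha] could be continued back to it, and its
    end would lie in the same strong component. *)
Lemma class_closed :
  (forall i : vertex B, i \in alpha \/ exists beta : {set vertex B},
     [/\ vertex_class beta, precedes beta alpha & i \in beta]) ->
  forall i j, i \in alpha -> (0 < incidence B j i)%N -> j \in alpha.
Proof.
move=> hsupp i j ia ij; have [//|[beta [cb [_ [w [w' [wb wa ww]]]] jb]]] := hsupp j.
apply: (mem_vertex_class ia); first exact: connect1.
apply: connect_trans (vertex_class_connect cb jb wb) _.
exact: connect_trans ww (vertex_class_connect halpha wa ia).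
Qed.

(** Primitivity is assumed of non-zero blocks; a positive eigenvector with positive eigenvalue shows
    that the block of [alpha] is one. *)
Lemma block_neq0 (lambda : R) (xi : 'cV[R]_#|alpha|) : 0 < lambda ->
  (forall i, 0 < xi i 0) -> block R alpha *m xi = lambda *: xi -> block R alpha != 0.
Proof.
move=> l_gt0 xi_gt0 hxi; have [w wE] := halpha.
have wa : w \in alpha by rewrite wE inE !connect0.
apply/eqP => b0; move: hxi; rewrite b0 mul0mx => /colP/(_ (enum_rank_in wa w)).
by rewrite !mxE => /esym/eqP; rewrite gt_eqF// mulr_gt0.
Qed.

End Support.

(** * The subdiagram of finite cylinders and its reduced vector *)

Section Reduced.
Variables (R : realType) (B : stationary_diagram).
Variable mu : {measure set (borel_paths B) -> \bar R}.
Variables (alpha : {set vertex B}) (lambda : R).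
Hypothesis halpha : vertex_class alpha.
Hypothesis hsupp : forall i : vertex B, i \in alpha \/ exists beta : {set vertex B},
     [/\ vertex_class beta, precedes beta alpha & i \in beta].
Hypothesis lambda_gt0 : 0 < lambda.
Hypothesis hmu : defined_by mu alpha lambda.

Let alpha_closed := class_closed halpha hsupp.

(** On [alpha] the weight is [xi]; elsewhere it is 0, as no path of a cylinder ending outside
    [alpha] at index [k] is in [alpha] from [k] on. *)
Lemma stays_measure : exists a : vertex B -> R, (forall i, 0 <= a i) /\
  forall x k, mu (cylinder x k `&` stays alpha k) = (a (vert x k) / lambda ^+ k)%:E.
Proof.
have [_ [xi [xi_gt0 _ hxi]]] := hmu.
have hc i : exists r, 0 <= r /\ forall x k, vert x k = i ->
    mu (cylinder x k `&` stays alpha k) = (r / lambda ^+ k)%:E.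
  case: (boolP (i \in alpha)) => [ia|nia].
    exists (xi (enum_rank_in ia i) 0); split=> [|x k xk]; first exact: ltW.
    by apply: hxi; rewrite enum_rankK_in.
  exists 0; split=> // x k xk; rewrite mul0r [X in mu X](_ : _ = set0) ?measure0//.
  rewrite -subset0 => y [[yx _] /(_ k (leqnn k))]; rewrite yx xk => ia.
  by rewrite ia in nia.
have [a aP] := choice hc.
by exists a; split=> [i|x k]; [have [] := aP i | have [_ ->] := aP (vert x k)].
Qed.

(** [finite_part] asks for finiteness of all cylinders ending in a class. One suffices, as bounds on
    [stay_mass] spread over the strong component. *)
Lemma finite_end_part i : finite_end mu i -> finite_part mu alpha i.
Proof.
have [a [a_ge0 mu_a]] := stays_measure.
have finP := finite_cylinderP alpha_closed lambda_gt0 hmu.1 mu_a.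
move=> [y [k [yi /finP]]]; rewrite yi => bi.
have [ia|[beta [cb pb ib]]] := hsupp i; first by left.
right; exists beta; split=> // x k' xb; apply/finP.
by apply: (bounded_mass_connect lambda_gt0 a_ge0 _ bi); exact: vertex_class_connect ib xb.
Qed.

Variables (n : nat) (v : 'I_n -> vertex B) (x : 'cV[R]_n).
Hypotheses (hv : injective v) (hrange : range v = finite_part mu alpha).
Hypothesis hx : reduced_vector mu lambda v x.

Lemma finite_endP i : finite_end mu i <-> exists j, v j = i.
Proof.
split=> [/finite_end_part|[j <-]].
  by rewrite -hrange => -[j _ <-]; exists j.
have [y yj] := path_through (v j) 0; exists y, 0%N; split=> //.
by have [_ _ _ /(_ _ _ _ yj) ->] := hx; rewrite ltry.
Qed.

Lemma class_in_range i : i \in alpha -> exists j, v j = i.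
Proof.
move=> ia; have : finite_part mu alpha i by left.
by rewrite -hrange => -[j _ <-]; exists j.
Qed.

(** The reduced vector is extended by 0 outside the subdiagram. As [alpha] lies in the subdiagram,
    the full equation at its vertices differs from the reduced one by zero terms only. *)
Lemma vertex_weights : exists X : vertex B -> R, (forall i, X (v i) = x i 0) /\
  forall i, i \in alpha -> edge_sum X i = lambda * X i.
Proof.
have hc w : exists r, (forall i, v i = w -> r = x i 0) /\ ((forall i, v i <> w) -> r = 0).
  case: (pselect (exists i, v i = w)) => [[i iw]|nw].
    by exists (x i 0); split=> [j jw|/(_ i)//]; congr (x _ 0); apply: hv; rewrite iw.
  by exists 0; split=> // i iw; exfalso; apply: nw; exists i.
have [X XP] := choice hc.
have Xv i : X (v i) = x i 0 by have [/(_ i erefl)] := XP (v i).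
exists X; split=> // w /class_in_range[i <-]; have [_ /colP/(_ i) + _ _] := hx.
rewrite !mxE Xv => <-; rewrite /edge_sum.
rewrite (bigID (mem (codom v)))/= [X in _ + X]big1 ?addr0; last first.
  move=> w' nw'; have [_ ->] := XP w'; first by rewrite mulr0.
  by move=> j jw'; rewrite -jw' codom_f in nw'.
rewrite -big_uniq /=; last by rewrite map_inj_uniq ?enum_uniq.
by rewrite big_image /=; apply: eq_bigr => j _; rewrite !mxE Xv.
Qed.

End Reduced.

(** * The criterion for goodness and its rational form *)

Lemma good_iff_group (R : realType) (B : stationary_diagram)
  (hprim : forall beta : {set vertex B}, vertex_class beta ->
     block R beta != 0 -> primitive (block R beta))
  (mu : {measure set (borel_paths B) -> \bar R})
  (alpha : {set vertex B}) (halpha : vertex_class alpha)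
  (hsupp : forall i : vertex B, i \in alpha \/
     exists beta : {set vertex B},
       [/\ vertex_class beta, precedes beta alpha & i \in beta])
  (lambda : R) (hlambda : 1 < lambda)
  (hmu : defined_by mu alpha lambda)
  (m n : nat) (v : 'I_n -> vertex B) (hv : injective v)
  (hrange : range v = finite_part mu alpha)
  (hm : forall i : 'I_n, (v i \in alpha) = (m <= i)%N)
  (x : 'cV[R]_n) (hx : reduced_vector mu lambda v x) :
  let G := addgroup_gen [set x j 0 | j in [set j : 'I_n | (m <= j)%N]] in
  (good mu <-> exists r : nat, forall i : 'I_n, G (lambda ^+ r * x i 0)) /\
  (forall u k, G u -> G (lambda ^+ k * u)).
Proof.
have l_gt0 : 0 < lambda by exact: lt_trans hlambda.
have ac := class_closed halpha hsupp.
have [mu0 [xi [xi_gt0 hxi _]]] := hmu.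
have prim := hprim _ halpha (block_neq0 halpha l_gt0 xi_gt0 hxi).
have [i0 i0E] := halpha.
have i0a : i0 \in alpha by rewrite i0E inE !connect0.
have [X [Xv X_eigen]] := vertex_weights hv hrange hx.
have [x_gt0 _ _ mu_x] := hx.
have fE := finite_endP halpha hsupp l_gt0 hmu hrange hx.
have X_gt0 i : i \in alpha -> 0 < X i.
  by move=> /(class_in_range hrange)[j <-]; rewrite Xv.
have X_fin i : finite_end mu i -> forall y k, vert y k = i ->
    mu (cylinder y k) = (X i / lambda ^+ k)%:E.
  by move=> /fE[j <-] y k yj; rewrite Xv (mu_x _ _ _ yj).
have X_alpha y k : vert y k \in alpha -> mu (cylinder y k) = (X (vert y k) / lambda ^+ k)%:E.
  by move=> ya; apply: X_fin => //; apply/fE; exact: (class_in_range hrange ya).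
have SE : [set x j 0 | j in [set j : 'I_n | (m <= j)%N]] = [set X j | j in [set` alpha]].
  rewrite eqEsubset; split=> [_ [j /= mj <-]|_ [w /= wa <-]].
    by exists (v j); rewrite ?Xv//= hm.
  have [j jw] := class_in_range hrange wa.
  by exists j; rewrite -?jw ?Xv//= -hm jw.
rewrite /= SE; split; last by move=> u k; exact: group_lambda.
split=> [gd|[r hr]].
  have [r hr] := good_group_uniform ac hlambda i0a X_gt0 X_eigen X_alpha X_fin gd.
  by exists r => i; rewrite -Xv; apply: hr; apply/fE; exists i.
apply: (group_good (r := r) ac mu0 hlambda prim X_gt0 X_eigen X_alpha X_fin).
by move=> _ /fE[i <-]; rewrite Xv.
Qed.

Theorem corollary3p5 (R : realType) (B : stationary_diagram)
  (haper : aperiodic B)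
  (hprim : forall beta : {set vertex B}, vertex_class beta ->
     block R beta != 0 -> primitive (block R beta))
  (mu : {measure set (borel_paths B) -> \bar R})
  (hinv : tail_invariant_measure mu) (herg : tail_ergodic mu)
  (hinf : mu [set: bpath B] = +oo%E)
  (alpha : {set vertex B}) (halpha : vertex_class alpha)
  (hsupp : forall i : vertex B, i \in alpha \/
     exists beta : {set vertex B},
       [/\ vertex_class beta, precedes beta alpha & i \in beta])
  (hfull : full_measure mu)
  (lambda : R) (hPF : lambda = spectral_radius (block R alpha))
  (hlambda : 1 < lambda)
  (hnd : ~ distinguished alpha lambda)
  (hmu : defined_by mu alpha lambda)
  (m n : nat) (v : 'I_n -> vertex B) (hv : injective v)
  (hrange : range v = finite_part mu alpha)
  (hm : forall i : 'I_n, (v i \in alpha) = (m <= i)%N)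
  (x : 'cV[R]_n) (hx : reduced_vector mu lambda v x) :
  (good mu <->
   exists r : nat, forall i : 'I_n, (i < m)%N ->
     addgroup_gen [set x j 0 | j in [set j : 'I_n | (m <= j)%N]]
       (lambda ^+ r * x i 0))
  /\
  (forall (p : 'I_n -> nat) (q : nat),
     (forall i, (0 < p i)%N) -> (0 < q)%N ->
     gcdn q (\big[gcdn/0%N]_(i < n) p i) = 1%N ->
     (forall i, x i 0 = (p i)%:R / q%:R) ->
     clopen_values mu `<=` range (@ratr R) ->
     (good mu <->
      exists r : nat, exists z : int,
        lambda ^+ r = z%:~R * (\big[gcdn/0%N]_(j < n | (m <= j)%N) p j)%:R)).
Proof.
have [] := good_iff_group hprim halpha hsupp hlambda hmu hv hrange hm hx.
set G := addgroup_gen _ => goodE G_lambda.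
(* At the vertices of [alpha] the condition holds with every exponent, so only those with [i < m]
   have to be tested. *)
have G_tail r (i : 'I_n) : (m <= i)%N -> G (lambda ^+ r * x i 0).
  by move=> mi; apply: G_lambda; apply: addgroup_genS; exists i.
have G0 : G 0 by exact: addgroup_gen0.
have GB u w : G u -> G w -> G (u - w) by exact: addgroup_genB.
split=> [|p q _ q_gt0 pq xE _].
  rewrite goodE; split=> -[r hr]; exists r => i //.
  by case: (leqP m i) => [/G_tail|/hr].
have q0 : q%:R != 0 :> R by rewrite pnatr_eq0 -lt0n.
set g := \big[gcdn/0%N]_(j < n | (m <= j)%N) p j.
have xMn i : x i 0 = q%:R^-1 *+ p i by rewrite xE mulr_natl.
(* This claim and the next one together say that [G] consists of the integer multiples of g / q. *)
have Gg : G (q%:R^-1 *+ g).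
  by apply: (closed_mulrn_biggcd G0 GB) => i mi; rewrite -xMn; apply: addgroup_genS; exists i.
have GE u : G u -> exists z : int, u * q%:R = z%:~R * g%:R.
  move: u; apply: addgroup_gen_ind.
  - by exists 0; rewrite !mul0r.
  - by move=> u w [y yE] [z zE]; exists (y - z); rewrite mulrBl yE zE rmorphB mulrBl.
  - move=> _ [j mj <-]; have /dvdnP[c pE] : (g %| p j)%N by exact: biggcdn_inf mj (dvdnn _).
    by exists c%:Z; rewrite xE mulfVK// pE natrM.
(* Since the entries of [x] sum to 1, [q] is the sum of the [p i], so their common divisors divide
   [q]. *)
have p1 : \big[gcdn/0%N]_(i < n) p i = 1%N.
  set h := \big[gcdn/0%N]_(i < n) p i.
  have hp i : (h %| p i)%N by exact: biggcdn_inf (dvdnn _).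
  have [_ _ x1 _] := hx.
  have qE : q = (\sum_i p i)%N.
    have : (\sum_i x i 0) * q%:R = (\sum_i p i)%N%:R.
      by rewrite mulr_suml natr_sum; apply: eq_bigr => i _; rewrite xE mulfVK.
    by rewrite x1 mul1r => /eqP; rewrite eqr_nat => /eqP.
  by rewrite -pq; apply/esym/gcdn_idPr; rewrite qE; apply: dvdn_sum.
rewrite goodE; split=> [[r hr]|[r [z rE]]]; exists r.
  (* The integer multiples of [g] form a group that contains all products of [lambda ^+ r] with some
     [p i], hence [lambda ^+ r] itself, the gcd of the [p i] being 1. *)
  pose P := [set u : R | exists z : int, u = z%:~R * g%:R].
  suff : P (lambda ^+ r *+ \big[gcdn/0%N]_(i < n) p i) by rewrite p1.
  apply: closed_mulrn_biggcd.
  - by exists 0; rewrite mul0r.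
  - by move=> _ _ [y ->] [z ->]; exists (y - z); rewrite rmorphB mulrBl.
  - by move=> i _; have [z zE] := GE _ (hr i); exists z; rewrite -zE xE mulrA mulfVK// mulr_natr.
move=> i; have -> : lambda ^+ r * x i 0 = (q%:R^-1 *+ g *+ p i) *~ z.
  rewrite rE xE -[RHS]mulrzl -[X in _ = _ * X]mulr_natl -[X in _ = _ * (_ * X)]mulr_natl.
  by rewrite -mulrA; congr (_ * _); exact: mulrCA.
have Gz : G (q%:R^-1 *+ g *+ p i) by exact: addgroup_genMn.
case: z {rE} => k; first by rewrite -pmulrn; exact: addgroup_genMn.
by rewrite NegzE mulrNz -pmulrn; apply: addgroup_genN; exact: addgroup_genMn.
Qed.
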